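(* Let $n\ge 2$ and let $q\in K^*$. If $q$ is not a root of unity, then the center of $T_q(n)$ is $Z(T_q(n))=K$.
   Context: $K$ is a field of characteristic different from $2$; $K^*=K\setminus\{0\}$. For $n\ge 2$ and $q\in K^*$, $T_q(n)$ is the unital associative $K$-algebra with generators $a_{ij}$, $1\le i\le j\le n$, and defining relations: $a_{jk}a_{ik}=q\,a_{ik}a_{jk}$ for $i<j\le k$; $a_{jk}a_{jl}=q\,a_{jl}a_{jk}$ for $j\le k<l$; $a_{ik}a_{jl}=a_{jl}a_{ik}$ for $i<j\le l$, $i\le k<l$; $a_{jk}a_{il}=q^2a_{il}a_{jk}$ for $i<j\le k<l$. *)

(* Defs.v *)
From HB Require Import structures.
From mathcomp Require Import all_boot all_algebra.
From mathcomp Require Import boolp classical_sets.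
From mathcomp.multinomials Require Import monalg.

Set Implicit Arguments.
Unset Strict Implicit.
Unset Printing Implicit Defensive.

Import GRing.Theory.
Local Open Scope ring_scope.
Local Open Scope quotient_scope.

Definition ring_center (A : nzRingType) : set A :=
  [set z | forall x, GRing.comm z x]%classic.

Arguments ring_center A : clear implicits.

Inductive ideal_gen (A : nzRingType) (S : A -> Prop) : A -> Prop :=
| IdealGen x of S x : ideal_gen S x
| Ideal0 : ideal_gen S 0
| IdealB x y of ideal_gen S x & ideal_gen S y : ideal_gen S (x - y)
| IdealM a b x of ideal_gen S x : ideal_gen S (a * x * b).

Section Tq.
Variables (K : fieldType) (n : nat) (q : K).

Definition Tidx := {p : 'I_n * 'I_n | (p.1 <= p.2)%N}.

(* The monoid algebra of the free monoid on Tidx, i.e. the free unital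
   associative K-algebra on generators indexed by Tidx. *)
Definition Tfree := {malg K[{fmonom Tidx}]}.

HB.instance Definition _ := GRing.Lalgebra.on Tfree.

(* Indices run over 0 .. n-1. The value 0 for j < i is junk: the relations
   below only involve generators with i <= j. *)
Definition Tgen (i j : 'I_n) : Tfree :=
  if insub (i, j) is Some p then << fmu (p : Tidx) >> else 0.

Local Notation a := Tgen.

Variant Trel : Tfree -> Prop :=
| TrelCol (i j k : 'I_n) of (i < j <= k)%N :
    Trel (a j k * a i k - q *: (a i k * a j k))
| TrelRow (j k l : 'I_n) of (j <= k < l)%N :
    Trel (a j k * a j l - q *: (a j l * a j k))
| TrelComm (i j k l : 'I_n) of (i < j <= l)%N & (i <= k < l)%N :
    Trel (a i k * a j l - a j l * a i k)
| TrelNest (i j k l : 'I_n) of (i < j)%N & (j <= k < l)%N :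
    Trel (a j k * a i l - q ^+ 2 *: (a i l * a j k)).

Definition Tideal : {pred Tfree} := [pred x | `[< ideal_gen Trel x >]].

Fact Tideal_zmod_closed : zmod_closed Tideal.
Proof.
split=> [|x y /asboolP xI /asboolP yI]; apply/asboolP; first exact: Ideal0.
exact: IdealB.
Qed.

HB.instance Definition _ :=
  GRing.isZmodClosed.Build Tfree Tideal Tideal_zmod_closed.

Fact TidealM x y z : y \in Tideal -> x * y * z \in Tideal.
Proof. by move=> /asboolP yI; apply/asboolP/IdealM. Qed.

Fact Tideal1 : 1 \notin Tideal.
Proof.
apply/negP => /asboolP I1.
pose c0 (x : Tfree) : K := @mcoeff {fmonom Tidx} K mone x.
have constM x y : c0 (x * y) = c0 x * c0 y.
  exact: (rmorphM (@mcoeff {fmonom Tidx} K mone)).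
have constZ c x : c0 (c *: x) = c * c0 x by exact: mcoeffZ.
have constB x y : c0 (x - y) = c0 x - c0 y by exact: mcoeffB.
have a0 i j : c0 (a i j) = 0.
  rewrite /c0 /Tgen; case: insubP => [p _ _|_]; last exact: mcoeff0.
  by rewrite mcoeffU1 fmP fmU fm1.
have c01 : c0 1 = 1 by rewrite /c0 mcoeff1 eqxx.
clearbody c0.
have c00 : c0 0 = 0 by rewrite -(subrr 0) constB subrr.
have rel0 u v w z c : c0 u = 0 -> c0 w = 0 -> c0 (u * v - c *: (w * z)) = 0.
  move=> u0 w0; rewrite constB (constM u v) constZ (constM w z) u0 w0.
  by rewrite !mul0r mulr0 subr0.
have I0 x : ideal_gen Trel x -> c0 x = 0.
  elim=> {x} [_ [] * | | x y _ x0 _ y0 | x y z _ z0].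
  - exact: rel0.
  - exact: rel0.
  - by rewrite -[X in _ - X]scale1r; apply: rel0.
  - exact: rel0.
  - exact: c00.
  - by rewrite constB x0 y0 subr0.
  - by rewrite !constM z0 mulr0 mul0r.
by have /eqP := I0 _ I1; rewrite c01 oner_eq0.
Qed.

(* The quotient of Tfree by the two-sided ideal Tideal generated by the
   defining relations. *)
Definition Tq := Quotient.quot Tideal.

HB.instance Definition _ := GRing.Zmodule.on Tq.
HB.instance Definition _ := EqQuotient.on Tq.

Definition Tpi (x : Tfree) : Tq := \pi_Tq x.

Fact TpiP x y : (Tpi x = Tpi y) <-> (x - y \in Tideal).
Proof.
rewrite (Quotient.idealrBE (Tideal : zmodClosed _)); split; first by move/eqP.
by move/eqP.
Qed.

Fact TpiB x y : Tpi (x - y) = Tpi x - Tpi y.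
Proof. exact: (raddfB (\pi_(Quotient.quot Tideal))). Qed.
Fact TpiD x y : Tpi (x + y) = Tpi x + Tpi y.
Proof. exact: (raddfD (\pi_(Quotient.quot Tideal))). Qed.

Fact TreprK (x : Tq) : Tpi (repr x) = x. Proof. exact: reprK. Qed.

Fact Tq_ind (P : Tq -> Prop) : (forall x, P (Tpi x)) -> forall x, P x.
Proof. by move=> Ppi x; rewrite -[x]TreprK. Qed.

Definition Tone : Tq := Tpi 1.
Definition Tmul (x y : Tq) : Tq := Tpi (repr x * repr y).
Definition Tscale (c : K) (x : Tq) : Tq := Tpi (c *: repr x).

Fact Tpi_mul x y : Tmul (Tpi x) (Tpi y) = Tpi (x * y).
Proof.
apply/TpiP.
have /TpiP hx := TreprK (Tpi x); have /TpiP hy := TreprK (Tpi y).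
set x' := repr _ in hx *; set y' := repr _ in hy *.
have -> : x' * y' - x * y = 1 * (x' - x) * y' + x * (y' - y) * 1.
  by rewrite mul1r mulr1 mulrBl mulrBr addrA subrK.
by rewrite rpredD ?TidealM.
Qed.

Fact TidealZ c x : x \in Tideal -> c *: x \in Tideal.
Proof. by move=> xI; rewrite -mul_malgC -[_ * _]mulr1 TidealM. Qed.

Fact Tpi_scale c x : Tscale c (Tpi x) = Tpi (c *: x).
Proof.
by apply/TpiP; rewrite -scalerBr TidealZ //; apply/TpiP; rewrite TreprK.
Qed.

Fact TmulA : associative Tmul.
Proof. by do 3!elim/Tq_ind=> ?; rewrite !Tpi_mul mulrA. Qed.
Fact Tmul1 : left_id Tone Tmul.
Proof. by elim/Tq_ind=> ?; rewrite !Tpi_mul mul1r. Qed.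
Fact TmulR1 : right_id Tone Tmul.
Proof. by elim/Tq_ind=> ?; rewrite !Tpi_mul mulr1. Qed.
Fact TmulDl : left_distributive Tmul +%R.
Proof. by do 3!elim/Tq_ind=> ?; rewrite -TpiD !Tpi_mul -TpiD mulrDl. Qed.
Fact TmulDr : right_distributive Tmul +%R.
Proof. by do 3!elim/Tq_ind=> ?; rewrite -TpiD !Tpi_mul -TpiD mulrDr. Qed.
Fact Tone_neq0 : Tone != 0.
Proof.
apply/eqP; rewrite -(subrr Tone) -TpiB => /TpiP.
by rewrite subrr subr0; apply/negP/Tideal1.
Qed.

HB.instance Definition _ := GRing.Zmodule_isNzRing.Build Tq
  TmulA Tmul1 TmulR1 TmulDl TmulDr Tone_neq0.

Fact TscaleA c d x : Tscale c (Tscale d x) = Tscale (c * d) x.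
Proof. by elim/Tq_ind: x => x; rewrite !Tpi_scale scalerA. Qed.
Fact Tscale1 : left_id 1 Tscale.
Proof. by elim/Tq_ind=> x; rewrite !Tpi_scale scale1r. Qed.
Fact TscaleDr : right_distributive Tscale +%R.
Proof.
by move=> c; do 2!elim/Tq_ind=> ?; rewrite -TpiD !Tpi_scale -TpiD scalerDr.
Qed.
Fact TscaleDl x : {morph Tscale^~ x : c d / c + d}.
Proof. by elim/Tq_ind: x => x c d; rewrite !Tpi_scale -TpiD scalerDl. Qed.

HB.instance Definition _ := GRing.Zmodule_isLmodule.Build K Tq
  TscaleA Tscale1 TscaleDr TscaleDl.

Fact TscaleAl (c : K) (x y : Tq) : c *: (x * y) = (c *: x) * y.
Proof.
elim/Tq_ind: x => x; elim/Tq_ind: y => y.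
by rewrite /GRing.scale /GRing.mul /= !(Tpi_mul, Tpi_scale) scalerAl.
Qed.

HB.instance Definition _ := GRing.Lmodule_isLalgebra.Build K Tq TscaleAl.

Fact TfreeZAr (c : K) (x y : Tfree) : c *: (x * y) = x * (c *: y).
Proof.
have mulC z : z * malgC c = c *: z.
  rewrite malgM_def fgmulgU malgZ_def; apply: eq_bigr => k _.
  by rewrite mulm1 mulrC.
by rewrite -[c *: y]mul_malgC mulrA mulC scalerAl.
Qed.

Fact TscaleAr (c : K) (x y : Tq) : c *: (x * y) = x * (c *: y).
Proof.
elim/Tq_ind: x => x; elim/Tq_ind: y => y.
by rewrite /GRing.scale /GRing.mul /= !(Tpi_mul, Tpi_scale) TfreeZAr.
Qed.

HB.instance Definition _ := GRing.Lalgebra_isAlgebra.Build K Tq TscaleAr.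

End Tq.

(* Main.v *)
(* With e(p, r) = [r.1 < p.1] + [p.2 < r.2] for intervals p, r, the defining
   relations read q^e(r, p) a_p a_r = q^e(p, r) a_r a_p, so T_q(n) is a quantum
   affine space: the sorted monomials span it, and weighting each word by a
   power of q counting its pairs of letters gives coefficient functionals on the
   free algebra that vanish on the ideal. Hence a central element is a
   combination of central monomials. A monomial commuting with a_(0, n-1) can
   only involve that generator, as e((0, n-1), r) = 0 < e(r, (0, n-1)) for all
   other r, and no nontrivial power of a_(0, n-1) commutes with a_(0, 0). *)

From HB Require Import structures.
Require Import Defs.
From mathcomp Require Import all_boot all_algebra.
From mathcomp Require Import classical_sets boolp finmap zify ring.
From mathcomp.multinomials Require Import monalg.

Set Implicit Arguments.
Unset Strict Implicit.
Unset Printing Implicit Defensive.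

Import GRing.Theory.
Local Open Scope ring_scope.

(** * Scalars, sums over fibres and invariance under rearrangement *)

(* Kept abstract, like the scaling lemmas below: in Tfree and Tq, matching
   products up to conversion unfolds the quotient and may not terminate. *)
Lemma mulr_regroup (R : pzSemiRingType) (y a x b z : R) :
  y * (a * x * b) * z = y * a * x * (b * z).
Proof. by rewrite !mulrA. Qed.

Lemma malgUZ (M : choiceType) (R : nzRingType) (c : R) (k : M) :
  << c *g k >> = c *: << k >>.
Proof. by apply/malgP => l; rewrite !mcoeffsE mulr_natr. Qed.

Lemma mmap_idfunZ (M : choiceType) (R : nzRingType) (h : M -> R) c x :
  mmap idfun h (c *: x) = c * mmap idfun h x.
Proof.
rewrite (mmapEw (msuppZ_le _ _)) mmapE mulr_sumr.
by apply: eq_bigr => k _; rewrite /= mcoeffZ mulrA.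
Qed.

(** Grouping the sum by the value of [r] leaves only the fibre over [j]. This will collect words
    with the same letters, [j] being the empty word. *)
Lemma big_fibre_scale (R : pzRingType) (V : lmodType R) (T J : choiceType)
    (S : {fset T}) (r : T -> J) (a : T -> R) (m : J -> V) (j : J) :
  (forall k, r k != j -> \sum_(l <- S | r l == r k) a l = 0) ->
  \sum_(k <- S) a k *: m (r k) = (\sum_(k <- S | r k == j) a k) *: m j.
Proof.
move=> a0; rewrite scaler_suml (bigID (fun k => r k == j)) /=.
rewrite [X in _ + X](_ : _ = 0) ?addr0; first by apply: eq_bigr => k /eqP->.
rewrite big_mkcond (partition_big_imfset _ r) big1_seq //= => i.
case/imfsetP => k /= kS ->; rewrite -big_mkcondr /=.
have [rk|rk] := eqVneq (r k) j.
  by rewrite big_pred0 // => l; case: eqVneq => //= ->; rewrite rk eqxx.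
transitivity (\sum_(l <- S | r l == r k) a l *: m (r k)); last first.
  by rewrite -scaler_suml a0 ?scale0r.
apply: eq_big => [l|l /andP[/eqP-> _]] //.
by case: eqVneq => //= ->.
Qed.

(** Since [c] ignores the order of letters, an equality of [m] on two rearrangements survives adding
    a prefix or a suffix. Swaps of neighbours then move the head letter to any position. *)
Lemma perm_twisted (K : pzRingType) (I : eqType) (A : lalgType K)
    (c : seq I -> seq I -> K) (m : seq I -> A) :
    (forall s t, m (s ++ t) = c s t *: (m s * m t)) ->
    (forall s t u, perm_eq s t -> c s u = c t u) ->
    (forall s t u, perm_eq s t -> c u s = c u t) ->
    (forall x y, m [:: x; y] = m [:: y; x]) ->
  forall s t, perm_eq s t -> m s = m t.
Proof.
move=> m_cat c_perml c_permr swap.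
have catl s t u : perm_eq s t -> m s = m t -> m (s ++ u) = m (t ++ u).
  by move=> st mE; rewrite !m_cat mE (c_perml s t).
have catr s t u : perm_eq s t -> m s = m t -> m (u ++ s) = m (u ++ t).
  by move=> st mE; rewrite !m_cat mE (c_permr s t).
have rot x s : m (x :: s) = m (rcons s x).
  elim: s => //= y s IH; transitivity (m (y :: x :: s)).
    apply: (catl [:: x; y] [:: y; x] s); last exact: swap.
    exact: permEl (perm_catC [:: x] [:: y]).
  apply: (catr (x :: s) (rcons s x) [:: y]); last exact: IH.
  by rewrite perm_sym perm_rcons.
elim=> [|x s IH] t; first by rewrite perm_sym => /perm_nilP->.
move=> xst; have xt : x \in t by rewrite -(perm_mem xst) mem_head.
case/splitPr: xt xst => t1 t2 xst.
have st : perm_eq s (t1 ++ t2).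
  by rewrite -(perm_cons x) (permPl xst) (perm_catCA t1 [:: x] t2).
rewrite (catr s _ [:: x] st (IH _ st)) -cat_rcons catA.
by apply: catl; rewrite ?rot // perm_sym perm_rcons.
Qed.

Lemma scaler_mulM (K : comPzRingType) (A : algType K) (a b : K) (x y : A) :
  (a *: x) * (b *: y) = (a * b) *: (x * y).
Proof. by rewrite -scalerAl -scalerAr scalerA. Qed.

Lemma scaler_cross (K : fieldType) (V : lmodType K) (a b : K) (x y : V) :
  a != 0 -> b != 0 -> b *: x = a *: y -> a^-1 *: x = b^-1 *: y.
Proof.
move=> a0 b0 xy; rewrite -[y](scalerK a0) -xy !scalerA; congr (_ *: _).
by rewrite mulrAC mulVf // mul1r.
Qed.

Section QuantumAffine.
Variables (K : fieldType) (n : nat) (q : K).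

Local Notation I := (Tidx n).
Local Notation F := (Tfree K n).
Local Notation A := (Tq n q).
Local Notation pi := (@Tpi K n q).
Implicit Types (p r : I) (s t u v w : seq I) (x y z : F).

(** * Words and the defining relations as weighted swaps *)

Definition word w : F := << FMonom w >>.

Lemma word_cat u v : word (u ++ v) = word u * word v.
Proof.
rewrite /word malgM_def fgmulUU mulr1; congr << _ *g _ >>.
by apply/eqP; rewrite fmP fmM.
Qed.

Lemma word_pair p r : word [:: p; r] = word [:: p] * word [:: r].
Proof. exact: (word_cat [:: p] [:: r]). Qed.

Lemma word_nil : word [::] = 1.
Proof. by rewrite /word -fmoneE. Qed.

Lemma free_words x : x = \sum_(k <- msupp x) x@_k *: word k.
Proof.
rewrite {1}(monalgE x); apply: eq_bigr => k _.
by rewrite malgUZ /word fmK.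
Qed.

Lemma Tgen_word (i j : 'I_n) (le_ij : (i <= j)%N) :
  Tgen K i j = word [:: Sub (i, j) le_ij].
Proof.
rewrite /Tgen; case: insubP => [p _ pE|]; last by rewrite /= le_ij.
by rewrite /word -fmuE; congr << fmu _ >>; apply: val_inj.
Qed.

(** Only [wt p r - wt r p] matters for commutation; splitting it into two natural numbers avoids
    negative powers of [q]. *)
Definition wt p r : nat :=
  (((val r).1 < (val p).1) + ((val p).2 < (val r).2))%N.

(** One shape for all four families, so that the coefficient functionals can treat them at once. *)
Lemma Trel_words x : Trel q x -> exists p r c,
  x = word [:: p; r] - c *: word [:: r; p] /\ q ^+ wt p r = c * q ^+ wt r p.
Proof.
case=> [i j k|j k l|i j k l|i j k l].
- move=> /andP[ij jk]; have ik : (i <= k)%N by lia.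
  exists (Sub (j, k) jk), (Sub (i, k) ik), q; rewrite !word_pair -!Tgen_word.
  by split=> //; rewrite /wt /= ij ltnn (ltnNge j i) (ltnW ij) mulr1.
- move=> /andP[jk kl]; have jl : (j <= l)%N by lia.
  exists (Sub (j, k) jk), (Sub (j, l) jl), q; rewrite !word_pair -!Tgen_word.
  by split=> //; rewrite /wt /= kl ltnn (ltnNge l k) (ltnW kl) mulr1.
- move=> /andP[ij jl] /andP[ik kl].
  exists (Sub (i, k) ik), (Sub (j, l) jl), 1.
  rewrite scale1r !word_pair -!Tgen_word; split=> //.
  by rewrite /wt /= ij kl (ltnNge l k) (ltnNge j i) (ltnW kl) (ltnW ij) mul1r.
- move=> ij /andP[jk kl]; have il : (i <= l)%N by lia.
  exists (Sub (j, k) jk), (Sub (i, l) il), (q ^+ 2).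
  rewrite !word_pair -!Tgen_word; split=> //.
  by rewrite /wt /= ij kl (ltnNge l k) (ltnNge j i) (ltnW kl) (ltnW ij) mulr1.
Qed.

(** The four families together cover every pair of distinct intervals. *)
Lemma word_swap p r :
  q ^+ wt r p *: pi (word [:: p; r]) = q ^+ wt p r *: pi (word [:: r; p]).
Proof.
have gen a : word [:: a] = Tgen K (val a).1 (val a).2.
  rewrite (Tgen_word (valP a)); congr (word [:: _]); apply: val_inj.
  by rewrite SubK; case: (val a).
have rel c d e x y : Trel q (x - c *: y) -> d * c = e ->
    d *: pi x = e *: pi y.
  move=> xyI <-; rewrite -scalerA; congr (_ *: _).
  by rewrite [RHS]Tpi_scale; apply/TpiP/asboolP; exact: IdealGen.
rewrite !word_pair !gen; case: p r => [[i k] /= ik] [[j l] /= jl].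
rewrite /wt /=.
(* The claim is symmetric, so the intervals may be taken in lexicographic order. *)
wlog: i j k l ik jl / (i < j)%N || ((i == j :> nat) && (k <= l))%N => [wlg|].
  have [ijkl|ijkl] := boolP ((i < j)%N || ((i == j :> nat) && (k <= l))%N).
    exact: wlg.
  by apply/esym/wlg => //; lia.
case/orP=> [ij|/andP[/eqP/val_inj<- kl]].
  rewrite ij (ltnNge j i) (ltnW ij) /=.
  case: (ltngtP k l) => [kl|lk|/val_inj kl].
  - apply: (rel 1); last exact: mulr1.
    by rewrite scale1r; apply: TrelComm; rewrite ?ij ?ik.
  - apply/esym/(rel (q ^+ 2)); last exact: mul1r.
    by apply: TrelNest; rewrite ?jl.
  - apply/esym/(rel q); last exact: mul1r.
    by rewrite kl; apply: TrelCol; rewrite ?ij.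
rewrite ltnn; move: kl; rewrite leq_eqVlt => /orP[/eqP/val_inj->|kl].
  by congr (_ *: _).
rewrite kl (ltnNge l k) (ltnW kl).
apply: (rel q); last exact: mul1r.
by apply: TrelRow; rewrite ?ik.
Qed.

(** * Weights of words and of pairs of words *)

Definition wt_cross s t : nat := (\sum_(p <- s) \sum_(r <- t) wt p r)%N.

(** Swapping adjacent letters changes this exponent exactly as the relations change the product, so
    it measures the power of [q] due to the ordering. *)
Fixpoint wt_word s : nat :=
  if s is p :: t then (wt_cross [:: p] t + wt_word t)%N else 0%N.

Lemma wt_cross_catl s t u :
  wt_cross (s ++ t) u = (wt_cross s u + wt_cross t u)%N.
Proof. by rewrite /wt_cross big_cat. Qed.

Lemma wt_cross_catr s t u :
  wt_cross u (s ++ t) = (wt_cross u s + wt_cross u t)%N.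
Proof.
by rewrite /wt_cross -big_split; apply: eq_bigr => p _; rewrite big_cat.
Qed.

Lemma wt_word_cat s t :
  wt_word (s ++ t) = (wt_word s + wt_word t + wt_cross s t)%N.
Proof.
elim: s => [|p s IH] /=; first by rewrite /wt_cross big_nil addn0.
rewrite IH wt_cross_catr -(cat1s p s) wt_cross_catl; lia.
Qed.

Lemma perm_wt_crossl s t u : perm_eq s t -> wt_cross s u = wt_cross t u.
Proof. by move=> st; apply: perm_big. Qed.

Lemma perm_wt_crossr s t u : perm_eq s t -> wt_cross u s = wt_cross u t.
Proof. by move=> st; apply: eq_bigr => p _; apply: perm_big. Qed.

(** Having exactly one exponent zero is what lets a single positive power of [q] decide the
    matter. *)
Lemma wt_cross_separates s : (2 <= n)%N -> s != [::] ->
  exists p, (wt_cross s [:: p] == 0%N) (+) (wt_cross [:: p] s == 0%N).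
Proof.
move=> n2 s0; have n0 : (0 < n)%N by lia.
have n1 : (n.-1 < n)%N by lia.
pose top : I := exist _ (Ordinal n0, Ordinal n1) (leq0n n.-1).
pose bot : I := exist _ (Ordinal n0, Ordinal n0) (leqnn 0).
have wt_top r : wt top r = 0%N.
  case: r => [[i j] ij]; rewrite /wt /=; have := ltn_ord j; lia.
have wt_to_top r : r != top -> (0 < wt r top)%N.
  apply: contraR; rewrite -eqn0Ngt addn_eq0 /= => /andP[r1 r2].
  apply/eqP/val_inj; case: r r1 r2 => [[i j] /= ij] i0 jn.
  by congr pair; apply: val_inj => /=; have := ltn_ord j; lia.
have [all_top|/allPn[r rs r_top]] := boolP (all (pred1 top) s).
  exists bot; case: s s0 all_top => //= r s _ /andP[/eqP-> /allP s_top].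
  have -> : wt_cross (top :: s) [:: bot] == 0%N.
    rewrite /wt_cross big_cons big_seq1 wt_top add0n big1_seq // => t.
    by case/andP=> _ /s_top/eqP->; rewrite big_seq1 wt_top.
  rewrite addTb /wt_cross big_seq1 big_cons addn_eq0 negb_and.
  (* [bot] and [top] differ because [n.-1] is positive. *)
  rewrite -lt0n wt_to_top //; apply/eqP => /(congr1 (fun r => val (val r).2)) /=.
  lia.
exists top; have -> : wt_cross [:: top] s == 0%N.
  by rewrite /wt_cross big_seq1 big1.
rewrite addbT /wt_cross (big_rem r) //= big_seq1 addn_eq0 negb_and.
by rewrite -lt0n wt_to_top.
Qed.

(** * Coefficient functionals on the free algebra *)

(* Up to a power of q, the word w equals the monomial with the same letters;
   word_coef s reads off the coefficient of the monomial of s. *)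
Definition word_coef s : F -> K :=
  mmap idfun (fun k : {fmonom I} => q ^+ wt_word k *+ perm_eq k s).

HB.instance Definition _ s := GRing.Additive.on (word_coef s).

Lemma word_coefZ s c x : word_coef s (c *: x) = c * word_coef s x.
Proof. exact: mmap_idfunZ. Qed.

Lemma word_coef_word s w :
  word_coef s (word w) = q ^+ wt_word w *+ perm_eq w s.
Proof. by rewrite /word_coef /word mmapU mul1r. Qed.

Lemma perm_word_coef s t : perm_eq s t -> word_coef s =1 word_coef t.
Proof.
move=> st x; rewrite /word_coef !mmapE.
by apply: eq_bigr => k _ /=; rewrite (permPr st).
Qed.

(** Appending [t] to a word gives a rearrangement of [s ++ t] only if the word rearranges [s], and
    then the extra weight depends on [s] and [t] alone. *)
Lemma word_coefMr s t x :
  word_coef (s ++ t) (x * word t) =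
  q ^+ (wt_word t + wt_cross s t) * word_coef s x.
Proof.
rewrite [x]free_words mulr_suml !raddf_sum mulr_sumr; apply: eq_bigr => k _ /=.
rewrite -scalerAl -word_cat !word_coefZ !word_coef_word perm_cat2r.
have [ks|_] /= := boolP (perm_eq k s); last by rewrite !mulr0n !mulr0.
rewrite wt_word_cat (perm_wt_crossl _ ks) mulrCA -exprD; congr (_ * q ^+ _).
lia.
Qed.

Lemma word_coefMl s t x :
  word_coef (t ++ s) (word t * x) =
  q ^+ (wt_word t + wt_cross t s) * word_coef s x.
Proof.
rewrite [x]free_words mulr_sumr !raddf_sum mulr_sumr; apply: eq_bigr => k _ /=.
rewrite -TfreeZAr -word_cat !word_coefZ !word_coef_word perm_cat2l.
have [ks|_] /= := boolP (perm_eq k s); last by rewrite !mulr0n !mulr0.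
by rewrite wt_word_cat (perm_wt_crossr _ ks) mulrCA -exprD addnAC.
Qed.

Lemma word_coef_context s x :
  (forall u v, word_coef s (word u * x * word v) = 0) ->
  forall y z, word_coef s (y * x * z) = 0.
Proof.
move=> x0 y z; rewrite [z]free_words mulr_sumr raddf_sum big1 // => l _ /=.
rewrite -TfreeZAr word_coefZ [y]free_words -mulrA mulr_suml raddf_sum.
rewrite big1 ?mulr0 // => k _ /=.
by rewrite -scalerAl word_coefZ mulrA x0 mulr0.
Qed.

(** The two words of a relation have the same letters, and in any context their weights differ only
    in the swapped pair, which the scalar of the relation compensates. *)
Lemma word_coef_Trel s x u v :
  Trel q x -> word_coef s (word u * x * word v) = 0.
Proof.
move=> /Trel_words[p [r [c [-> cE]]]].
rewrite mulrBr mulrBl raddfB /= -TfreeZAr -scalerAl word_coefZ.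
have coef_cat t : word_coef s (word u * word t * word v) =
    q ^+ wt_word (u ++ t ++ v) *+ perm_eq (u ++ t ++ v) s.
  by rewrite -word_coef_word catA 2!word_cat.
apply/eqP; rewrite subr_eq0; apply/eqP.
rewrite [LHS]coef_cat [X in c * X]coef_cat.
have /permPl-> : perm_eq (u ++ [:: r; p] ++ v) (u ++ [:: p; r] ++ v).
  by rewrite perm_cat2l perm_cat2r (perm_catC [:: r] [:: p]).
rewrite mulrnAr; congr (_ *+ _).
have rp_pr : perm_eq [:: r; p] [:: p; r] by rewrite (perm_catC [:: r] [:: p]).
rewrite !wt_word_cat (perm_wt_crossl v rp_pr) !wt_cross_catr.
rewrite (perm_wt_crossr u rp_pr) !exprD /= /wt_cross !big_seq1 !big_nil.
by rewrite !expr0 !mulr1 cE; ring.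
Qed.

Lemma word_coef_ideal s x : x \in @Tideal K n q -> word_coef s x = 0.
Proof.
(* Arbitrary factors [y] and [z] make the induction absorb multiplication on both sides. *)
move=> /asboolP xI; suff ctx y z : word_coef s (y * x * z) = 0.
  by rewrite -[x]mul1r -[1 * x]mulr1.
elim: xI y z => {x} [x xR||x x' _ IH _ IH'|a b x _ IH] y z.
- by apply: word_coef_context => u v; apply: word_coef_Trel.
- by rewrite mulr0 mul0r raddf0.
- rewrite mulrBr mulrBl raddfB /=.
  exact: etrans (congr2 (fun c d => c - d) (IH y z) (IH' y z)) (subrr 0).
- by rewrite (mulr_regroup y a x b z); exact: IH.
Qed.

(** Compare the coefficients at [s ++ [:: p]] of both products: each is a power of [q] times the
    nonzero coefficient at [s]. *)
Lemma central_word_coef s x p : word_coef s x != 0 ->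
  pi (x * word [:: p]) = pi (word [:: p] * x) ->
  q ^+ wt_cross s [:: p] = q ^+ wt_cross [:: p] s.
Proof.
move=> sx /TpiP /(word_coef_ideal (s ++ [:: p])).
rewrite raddfB /= => /subr0_eq coefE; apply: (mulIf sx).
have wt1 : wt_word [:: p] = 0%N by rewrite /= /wt_cross big_seq1 big_nil.
have coefMr := word_coefMr s [:: p] x; have coefMl := word_coefMl s [:: p] x.
rewrite wt1 add0n in coefMr; rewrite wt1 add0n in coefMl.
rewrite -[LHS]coefMr -[RHS]coefMl [LHS]coefE.
exact/perm_word_coef/permEl/perm_catC.
Qed.

(** * Monomials spanning the quotient *)

Hypothesis q_neq0 : q != 0.

(* Dividing out the scalar makes this invariant under permutations of s. *)
Definition monom s : A := (q ^+ wt_word s)^-1 *: pi (word s).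

Lemma pi_word s : pi (word s) = q ^+ wt_word s *: monom s.
Proof. by rewrite scalerA divff ?scale1r ?expf_neq0. Qed.

Lemma monom_cat s t :
  monom (s ++ t) = (q ^+ wt_cross s t)^-1 *: (monom s * monom t).
Proof.
have piM : pi (word (s ++ t)) = pi (word s) * pi (word t).
  by rewrite [RHS]Tpi_mul word_cat.
rewrite {1}/monom piM wt_word_cat !exprD !invfM.
rewrite scaler_mulM scalerA; congr (_ *: _).
by ring.
Qed.

Lemma perm_monom s t : perm_eq s t -> monom s = monom t.
Proof.
apply: (perm_twisted monom_cat) => [u v w uv|u v w uv|p r].
- by rewrite (perm_wt_crossl w uv).
- by rewrite (perm_wt_crossr w uv).
have wt2 a b : wt_word [:: a; b] = wt a b.
  by rewrite /= /wt_cross !big_seq1 !big_nil !addn0.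
rewrite /monom !wt2.
by apply: scaler_cross; [apply: expf_neq0.. | apply: word_swap].
Qed.

(** A chosen rearrangement replaces the sorted word, so no order on the generators is needed. *)
Definition perm_repr s := choose (perm_eq s) s.

Lemma perm_reprP s : perm_eq s (perm_repr s).
Proof. exact: chooseP. Qed.

Lemma eq_perm_repr s t : (perm_repr s == perm_repr t) = perm_eq s t.
Proof.
apply/eqP/idP => [st|st].
  by rewrite (permPl (perm_reprP s)) st perm_sym perm_reprP.
rewrite /perm_repr (@eq_choose _ (perm_eq s) (perm_eq t)).
  by apply: choose_id; rewrite // perm_sym.
by move=> u; apply: permPl.
Qed.

(** Collecting words by their letters, the class of [s] has total coefficient [word_coef s x], so
    only the empty class, a multiple of 1, survives. *)
Lemma pi_scalar x :
  (forall s, s != [::] -> word_coef s x = 0) -> exists c, pi x = c *: 1.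
Proof.
move=> x0.
have pi0 : pi 0 = 0 by rewrite -(subrr 0) TpiB subrr.
have piZ c y : pi (c *: y) = c *: pi y by exact/esym/Tpi_scale.
have piE : pi x = \sum_(k <- msupp x)
    (x@_k * q ^+ wt_word k) *: monom (perm_repr k).
  rewrite {1}(free_words x) (big_morph pi (@TpiD K n q) pi0).
  apply: eq_bigr => k _; rewrite [LHS]piZ.
  by rewrite pi_word [LHS]scalerA (perm_monom (perm_reprP k)).
have repr0 : perm_repr [::] = [::].
  by apply/perm_nilP; rewrite perm_sym perm_reprP.
have -> : 1 = monom [::] by rewrite /monom word_nil /= expr0 invr1 scale1r.
eexists; rewrite piE; apply: (@big_fibre_scale _ _ _ _ _ _ _ _ [::]) => k.
rewrite -repr0 eq_perm_repr => k0.
have /x0 : val k != [::] by apply: contraNneq k0 => ->.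
rewrite [word_coef _ _]mmapE => kx; rewrite big_mkcond -[RHS]kx.
apply: eq_bigr => l _; rewrite eq_perm_repr /=.
by case: perm_eq; rewrite ?mulr0n ?mulr0 ?mulr1n.
Qed.

End QuantumAffine.

(** * The center *)

Theorem proposition2p7 (K : fieldType) (charK : 2%N \notin [pchar K])
    (n : nat) (n_ge2 : (2 <= n)%N) (q : K) (q_neq0 : q != 0)
    (q_nroot : ~ exists2 m : nat, (0 < m)%N & m.-unity_root q) :
  ring_center (Tq n q) = range (in_alg (Tq n q)).
Proof.
have qX m : (0 < m)%N -> q ^+ m <> 1.
  by move=> m0 qm; apply: q_nroot; exists m => //; apply/unity_rootP.
(* With exactly one exponent zero, equality would make a positive power of [q] equal to 1. *)
have qX_inj a b : (a == 0%N) (+) (b == 0%N) -> q ^+ a <> q ^+ b.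
  by case: a b => [|a] [|b] // _; [move/esym|]; apply: qX.
apply/seteqP; split; last first.
  move=> _ [c _ <-] x; rewrite /GRing.comm.
  by rewrite -scalerAl mul1r -scalerAr mulr1.
move=> z; elim/Tq_ind: z => x xC.
suff coef0 s : s != [::] -> word_coef q s x = 0.
  by have [c ->] := pi_scalar q_neq0 coef0; exists c.
move=> s0; apply/eqP/negPn/negP => sx.
have [p p_sep] := wt_cross_separates n_ge2 s0.
have xp : Tpi q (x * word K [:: p]) = Tpi q (word K [:: p] * x).
  by rewrite -[LHS]Tpi_mul -[RHS]Tpi_mul; exact: xC.
exact: qX_inj p_sep (central_word_coef sx xp).
Qed.
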